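(* Let $k\ge 7$ and $2k\le n\le 3k-4$ be integers. Then $$|\mathcal{A}(n,k)|>|\mathcal{T}(n,k)|,$$ where $\mathcal{A}(n,k)=\left\{F\in\binom{[n]}{k}: |F\cap\{1,2,3,4\}|\ge 3\right\}$.
   Context: $[n]=\{1,\dots,n\}$ and $\binom{[n]}{k}$ is the collection of all $k$-element subsets of $[n]$. The family $\mathcal{T}(n,k)$ is defined as follows: fix $T_0\in\binom{[n]}{k}$ with $T_0\cap\{1,2\}=\{2\}$ and put $\mathcal{T}(n,k)=\{T_0\}\cup\{T\in\binom{[n]}{k}: 1\in T,\ T\cap T_0=\emptyset\}\cup\{T\in\binom{[n]}{k}:\{1,2\}\subset T\}$; its size is $1+\binom{n-k-1}{k-1}+\binom{n-2}{k-2}$. *)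

(* Defs.v *)
From mathcomp Require Import all_boot.

Set Implicit Arguments.
Unset Strict Implicit.
Unset Printing Implicit Defensive.

(* The ground set [n] = {1, ..., n} is 'I_n, where i : 'I_n stands for the
   integer i.+1.  [labelled n s] is the subset of [n] whose elements are the
   integers listed in s; a label outside 1..n is dropped. *)
Definition labelled (n : nat) (s : seq nat) : {set 'I_n} :=
  [set i : 'I_n | i.+1 \in s].

Definition ksubsets (n k : nat) : {set {set 'I_n}} :=
  [set F : {set 'I_n} | #|F| == k].

Definition familyA (n k : nat) : {set {set 'I_n}} :=
  [set F in ksubsets n k | 3 <= #|F :&: labelled n [:: 1; 2; 3; 4]|].

Definition admissible_T0 (n k : nat) (T0 : {set 'I_n}) : Prop :=
  T0 \in ksubsets n k /\ T0 :&: labelled n [:: 1; 2] = labelled n [:: 2].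

(* For n >= 1, "1 \in T" is the inclusion of the singleton {1} in T. *)
Definition familyT (n k : nat) (T0 : {set 'I_n}) : {set {set 'I_n}} :=
  [set T0]
  :|: [set T in ksubsets n k | labelled n [:: 1] \subset T & T :&: T0 == set0]
  :|: [set T in ksubsets n k | labelled n [:: 1; 2] \subset T].

(* Main.v *)
Require Import Defs.
From mathcomp Require Import all_boot.
From mathcomp Require Import zify.

(** Splitting the [k]-sets by their trace on [{1,2}] and on [{1,2,3,4}] reduces
    the claim to [1 + 'C(n-k-1, k-1) + 'C(n-4, k-2) < 2 * 'C(n-4, k-3)].  Since
    [n <= 3k-4], the difference [2 'C(n-4, k-3) - 'C(n-4, k-2)] is at least
    ['C(n-4, k-3) / (k-2)].  Put [p = n-k-1 <= 2k-5].  In the Vandermonde sum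
    ['C(n-4, k-3) = \sum_i 'C(p, i) 'C(k-3, i)], the terms [i = k-3] and
    [i = k-4] together are at least [(k-2) 'C(p, k-1)], and the term [i = 1]
    alone exceeds [k-2]. *)

(** Lower [a] one step at a time: [(a+1) 'C(p, a+1) = (p-a) 'C(p, a)], and [p - a <= b <= a] as long
    as [p <= a + b]. The boundary case [p = a + 1 + b] is the symmetry of the row. *)
Lemma leq_bin_upper_half (p a b : nat) :
  b <= a -> p <= a + b -> 'C(p, a) <= 'C(p, b).
Proof.
elim: a => [|a IHa]; first by rewrite leqn0 => /eqP->.
rewrite leq_eqVlt => /predU1P[->//|]; rewrite ltnS => le_ba.
rewrite leq_eqVlt => /predU1P[p_eq|lt_p].
  by rewrite -bin_sub; [rewrite p_eq addKn | lia].
apply: (leq_trans _ (IHa le_ba _)); last by lia.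
by rewrite -(leq_pmul2l (ltn0Sn a)) mul_bin_left leq_mul2r; lia.
Qed.

Lemma binS_lt_bin (k n : nat) :
  7 <= k -> 2 * k <= n -> n <= 3 * k - 4 ->
  (k - 2) * ('C(n - k - 1, k - 1)).+1 < 'C(n - 4, k - 3).
Proof.
move=> hk hn1 hn2; set p := n - k - 1.
have -> : n - 4 = p + (k - 3) by lia.
rewrite -Vandermonde -(big_mkord xpredT (fun i => 'C(p, i) * 'C(k - 3, k - 3 - i))).
rewrite big_nat_recr // /= subnn bin0 muln1.
(* Writing [k = j + 7] lets the terms of index [k-3], [k-4], [0] and [1] be split off in turn. *)
have [j kE] : exists j, k = j.+2 + 5 by exists (k - 7); lia.
have -> : k - 3 = (j.+2).+2 by lia.
rewrite big_nat_recr // subSnn bin1 /=.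
rewrite big_nat_recl // big_nat_recl //= bin1.
have -> : (j.+4 - 1) = j.+3 by lia.
have -> : 'C(j.+4, j.+3) = j.+4 by rewrite binSn.
(* Here [n <= 3 * k - 4] is tight: [(k-1) + (k-4) = 2k-5] is the largest possible [p]. *)
have le3 : 'C(p, k - 1) <= 'C(p, j.+3) by apply: leq_bin_upper_half; lia.
have le4 : 'C(p, k - 1) <= 'C(p, j.+4) by apply: leq_bin_upper_half; lia.
have -> : k - 2 = j.+4.+1 by lia.
have : k - 1 <= p by lia.
by rewrite bin0; nia.
Qed.

Lemma bin_ineq (k n : nat) :
  7 <= k -> 2 * k <= n -> n <= 3 * k - 4 ->
  1 + 'C(n - k - 1, k - 1) + 'C(n - 4, k - 2) < 2 * 'C(n - 4, k - 3).
Proof.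
move=> hk hn1 hn2; have := binS_lt_bin _ _ hk hn1 hn2.
have := mul_bin_left (n - 4) (k - 3).
have -> : (k - 3).+1 = k - 2 by lia.
have : n - 4 - (k - 3) + 1 <= 2 * (k - 2) by lia.
move: 'C(n - k - 1, _) 'C(_, k - 3) 'C(_, k - 2) (_ - (k - 3)) => x y z d.
have : 0 < k - 2 by lia.
(* With [c * z = d * y]: [c (1 + x + z) < y + d y <= 2 c y]. *)
by move: (k - 2) => c; nia.
Qed.

(** [G |-> A :|: G] is a bijection from the [(k - #|A|)]-subsets of the complement of [S], with
    inverse [F |-> F :\: S]. *)
Lemma card_ksets_trace (T : finType) (k : nat) (S A : {set T}) :
  A \subset S -> #|A| <= k ->
  #|[set F : {set T} | (#|F| == k) && (F :&: S == A)]| =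
    'C(#|T| - #|S|, k - #|A|).
Proof.
move=> sAS leAk; have <- : #|~: S| = #|T| - #|S| by rewrite cardsCs setCK.
rewrite -cards_draws.
have disj (G : {set T}) : G \subset ~: S -> G :&: S = set0.
  by move=> sG; apply: disjoint_setI0; rewrite disjoints_subset.
rewrite -[RHS](card_in_imset (f := fun G => A :|: G)); last first.
  move=> G H; rewrite !inE => /andP[sG _] /andP[sH _] eqGH.
  have dA (B : {set T}) : B \subset ~: S -> (A :|: B) :\: S = B.
    move=> sB; move: sAS; rewrite setDUl -setD_eq0 => /eqP->.
    by rewrite set0U; apply/setDidPl; rewrite disjoints_subset.
  by rewrite -(dA G) // eqGH dA.
apply: eq_card => F; rewrite inE; apply/andP/imsetP => [[/eqP cF /eqP FS]|].
  exists (F :\: S); last by rewrite -FS setID.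
  by rewrite inE subsetDr cardsD cF FS eqxx.
case=> G; rewrite inE => /andP[sG /eqP cG] ->.
rewrite setIUl (setIidPl sAS) (disj G sG) setU0 eqxx; split=> //.
rewrite cardsU (_ : A :&: G = set0) ?cards0 ?cG; first by apply/eqP; lia.
by apply/eqP; rewrite -subset0 -(disj G sG) setIC setIS.
Qed.

Lemma card_ksets_meeting (T : finType) (k j : nat) (S : {set T}) :
  j <= k ->
  #|[set F : {set T} | (#|F| == k) && (#|F :&: S| == j)]| =
    'C(#|S|, j) * 'C(#|T| - #|S|, k - j).
Proof.
move=> le_jk; rewrite -cards_draws -sum1_card.
rewrite (partition_big (fun F => F :&: S)
  (mem [set A : {set T} | (A \subset S) && (#|A| == j)])) /=; last first.
  by move=> F; rewrite !inE subsetIr => /andP[].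
rewrite -sum_nat_const; apply: eq_bigr => A; rewrite inE => /andP[sAS /eqP cA].
rewrite -cA -card_ksets_trace ?cA // -sum1_card.
apply: eq_bigl => F; rewrite !inE -andbA; case: (F :&: S =P A) => [->|].
  by rewrite cA eqxx.
by rewrite !andbF.
Qed.

Lemma card_labelled_iota (n m : nat) : m <= n -> #|labelled n (iota 1 m)| = m.
Proof.
move=> le_mn; rewrite -sum1_card -[RHS]card_ord -sum1_card.
rewrite (big_ord_widen n (fun=> 1)) //; apply: eq_bigl => i.
by rewrite inE mem_iota.
Qed.

Lemma card_familyA (n k : nat) :
  4 <= n -> 4 <= k ->
  #|familyA n k| = 4 * 'C(n - 4, k - 3) + 'C(n - 4, k - 4).
Proof.
move=> hn hk; set S := labelled n [:: 1; 2; 3; 4].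
have cS : #|S| = 4 by apply: (card_labelled_iota n 4).
have -> : familyA n k =
    [set F : {set 'I_n} | (#|F| == k) && (#|F :&: S| == 3)]
    :|: [set F : {set 'I_n} | (#|F| == k) && (#|F :&: S| == 4)].
  apply/setP=> F; rewrite !inE -andb_orr; congr (_ && _).
  by have := subset_leq_card (subsetIr F S); rewrite cS -/S; lia.
rewrite cardsU !card_ksets_meeting ?cS ?card_ord //; last by lia.
rewrite (_ : _ :&: _ = set0); last first.
  by apply/setP=> F; rewrite !inE; case: eqP => //= _; case: eqP => // ->.
by rewrite cards0 subn0 binSn binn mul1n.
Qed.

(** A union bound over the three pieces; the last two are prescribed-trace families. *)
Lemma card_familyT_le (n k : nat) (T0 : {set 'I_n}) :
  2 <= n -> 2 <= k -> admissible_T0 k T0 ->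
  #|familyT k T0| <= 1 + 'C(n - k - 1, k - 1) + 'C(n - 2, k - 2).
Proof.
move=> hn hk [/[!inE] /eqP cT0 trace_T0].
have c1 : #|labelled n [:: 1]| = 1 by apply: (card_labelled_iota n 1); lia.
have c2 : #|labelled n [:: 1; 2]| = 2 by apply: (card_labelled_iota n 2).
have d1 : labelled n [:: 1] :&: T0 = set0.
  apply/setP=> i; move/setP/(_ i): trace_T0; rewrite !inE.
  by case: (i \in T0); case: eqP => // ->.
apply: (leq_trans (leq_card_setU _ _)).
apply: leq_add; first (apply: (leq_trans (leq_card_setU _ _)); apply: leq_add).
- by rewrite cards1.
(* Containing 1 and avoiding [T0] means having trace [{1}] on [{1} :|: T0], which has [k + 1]
   elements because 1 is not in [T0]. *)
- have cU : #|labelled n [:: 1] :|: T0| = k + 1.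
    by rewrite cardsU d1 cards0 c1 cT0; lia.
  have le1 : #|labelled n [:: 1]| <= k by lia.
  have := card_ksets_trace _ _ _ _ (subsetUl _ T0) le1.
  rewrite cU c1 card_ord subnDA => <-.
  apply: subset_leq_card; apply/subsetP=> F.
  rewrite !inE => /andP[-> /andP[sF /eqP dF]] /=.
  by rewrite setIUr dF setU0 (setIidPr sF).
have le2 : #|labelled n [:: 1; 2]| <= k by rewrite c2.
have := card_ksets_trace _ _ _ _ (subxx _) le2.
rewrite c2 card_ord => <-.
apply: subset_leq_card; apply/subsetP=> F.
by rewrite !inE => /andP[-> /setIidPr->] /=.
Qed.

Theorem proposition1p11 (n k : nat) (T0 : {set 'I_n})
    (hk : 7 <= k) (hn1 : 2 * k <= n) (hn2 : n <= 3 * k - 4)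
    (hT0 : admissible_T0 k T0) :
  #|familyT k T0| < #|familyA n k|.
Proof.
rewrite card_familyA; [|lia|lia].
have n2 : 2 <= n by lia.
have k2 : 2 <= k by lia.
apply: (leq_ltn_trans (card_familyT_le _ _ _ n2 k2 hT0)).
have := bin_ineq _ _ hk hn1 hn2.
(* Pascal's rule twice gives ['C(n-2, k-2) = 'C(n-4, k-2) + 2 'C(n-4, k-3) + 'C(n-4, k-4)];
   cancelling against the size of [familyA n k] leaves exactly [bin_ineq]. *)
have -> : n - 2 = (n - 4).+2 by lia.
have -> : k - 2 = (k - 4).+2 by lia.
have -> : k - 3 = (k - 4).+1 by lia.
by rewrite !binS; lia.
Qed.
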